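(* Let $H$ be a complex Hilbert space, let $L_0$ be a (densely defined) symmetric minimal operator in $H$, let $\widehat{L}=L_0^*$ be the corresponding maximal operator, let $L$ be a self-adjoint correct extension of $L_0$, and let $L_K$ be a correct restriction of $\widehat{L}$, with $$L_K^{-1}f=L^{-1}f+Kf,\qquad f\in H,$$ where $K$ is a bounded linear operator on $H$ with $R(K)\subset \operatorname{Ker}\widehat{L}$. If $R(K^* )\subset D(L)$, $I+KL\ge 0$, $I+KL$ is invertible, and $L^{-1}$ is a compact operator, then the system of eigenvectors of $L_K$ forms a Riesz basis in $H$.
   Context: $D(\cdot)$, $R(\cdot)$, $\operatorname{Ker}$ denote domain, range and kernel; $I$ is the identity on $H$. A linear operator $A$ in $H$ is correctly solvable if there is $C>0$ with $\|u\|\le C\|Au\|$ for all $u\in D(A)$, and everywhere solvable if $R(A)=H$; $A$ is a correct operator if both hold (so $A^{-1}$ is a bounded operator defined on all of $H$). A correctly solvable operator $L_0$ is minimal if $\overline{R(L_0)}\ne H$. A closed operator $\widehat{L}$ is maximal if $R(\widehat{L})=H$ and $\operatorname{Ker}\widehat{L}\neq\{0\}$. $A$ is a restriction of $B$ (and $B$ an extension of $A$) if $D(A)\subset D(B)$ and $Au=Bu$ for $u\in D(A)$. A correct extension of $L_0$ (correct restriction of $\widehat L$) is an extension of $L_0$ (restriction of $\widehat L$) that is a correct operator. Every correct restriction $L_K$ of $\widehat{L}$ has inverse $L_K^{-1}=L^{-1}+K$ for a bounded linear operator $K$ from $H$ into $\operatorname{Ker}\widehat{L}$, and then $D(L_K)=\{u\in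 D(\widehat{L}): (I-K\widehat{L})u\in D(L)\}$. When $R(K^* )\subset D(L)$ (with $L=L^*$), the operator $KL$, defined on the dense set $D(L)$, is bounded there; $KL$ denotes its bounded extension (closure) to all of $H$. For a bounded operator $T$ on $H$, $T\ge 0$ means $(Tx,x)\ge 0$ for all $x\in H$, and invertible means having a bounded inverse defined on all of $H$. A Riesz basis of $H$ is the image of an orthonormal basis of $H$ under a bounded, boundedly invertible operator on $H$. As usual, ''the system of eigenvectors forms a Riesz basis'' means that, with a suitable choice of basis in each eigenspace and suitable normalization, the eigenvectors form a Riesz basis, i.e. there is a Riesz basis of $H$ consisting of eigenvectors. *)

(* Defs.v *)
From mathcomp Require Import all_boot all_order all_algebra.
From mathcomp Require Import complex.
From mathcomp Require Import all_classical all_reals all_analysis.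
Import Order.TTheory GRing.Theory Num.Theory.
Import numFieldNormedType.Exports.

Set Implicit Arguments.
Unset Strict Implicit.
Unset Printing Implicit Defensive.

Local Open Scope classical_set_scope.
Local Open Scope complex_scope.
Local Open Scope ring_scope.

(** [{dot H for Num.conj}] is linear in its first argument.  A complex Hilbert
    space is a complete normed module over [R[i]] whose norm comes from such a
    form; norms are [R[i]]-valued, and [0 <= z] in [R[i]] entails that [z] is
    real. *)
Definition hilbert_norm (R : realType) (H : normedModType R[i])
  (ip : {dot H for Num.conj}) : Prop := forall x : H, `|x| ^+ 2 = ip x x.

(** The values of [op_fun A] outside [op_dom A] are irrelevant. Linearity is
    the separate predicate [linear_op], so that adjoints and closures can be
    formed without side conditions. *)
Record operator (T : Type) := Operator {
  op_dom : set T;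
  op_fun :> T -> T }.

Section Operators.
Context {R : realType} {H : normedModType R[i]}.
Implicit Types (A B : operator H) (T : H -> H).

Definition linear_op A : Prop :=
  op_dom A 0 /\
  forall (a : R[i]) (u v : H), op_dom A u -> op_dom A v ->
    op_dom A (a *: u + v) /\ A (a *: u + v) = a *: A u + A v.

Definition op_range A : set H := A @` op_dom A.

Definition op_ker A : set H := [set u | op_dom A u /\ A u = 0].

Definition op_graph A : set (H * H) := [set p | op_dom A p.1 /\ A p.1 = p.2].

Definition restriction A B : Prop :=
  op_dom A `<=` op_dom B /\ forall u, op_dom A u -> A u = B u.

Definition op_eq A B : Prop := restriction A B /\ restriction B A.

Definition closed_op A : Prop := closed (op_graph A).

(** The operator whose graph is the closure of the graph of [A], when that
    closure is single-valued. *)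
Definition closure_op A : operator H :=
  {| op_dom := [set x | exists y, closure (op_graph A) (x, y)];
     op_fun := fun x => xget 0 [set y | closure (op_graph A) (x, y)] |}.

Definition inverse_op A : H -> H :=
  fun f => xget 0 [set u | op_dom A u /\ A u = f].

Definition everywhere_op T : operator H := {| op_dom := setT; op_fun := T |}.

Definition comp_op T A : operator H :=
  {| op_dom := op_dom A; op_fun := fun u => T (A u) |}.

Definition correctly_solvable A : Prop :=
  exists2 C : R[i], 0 < C & forall u, op_dom A u -> `|u| <= C * `|A u|.

Definition everywhere_solvable A : Prop := op_range A = setT.

Definition correct_op A : Prop :=
  correctly_solvable A /\ everywhere_solvable A.

Definition minimal_op A : Prop :=
  correctly_solvable A /\ closure (op_range A) <> setT.

Definition maximal_op A : Prop :=
  [/\ closed_op A, op_range A = setT & op_ker A <> [set 0]].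

Definition bounded_linear T : Prop :=
  linear T /\ exists2 C : R[i], 0 < C & forall x, `|T x| <= C * `|x|.

Definition invertible T : Prop :=
  exists S : H -> H, [/\ bounded_linear S, cancel T S & cancel S T].

Definition compact_operator T : Prop :=
  linear T /\ forall B : set H, bounded_set B -> precompact (T @` B).

Definition eigenvector A (u : H) : Prop :=
  [/\ op_dom A u, u <> 0 & exists lambda : R[i], A u = lambda *: u].

Definition lin_span (E : set H) : set H :=
  [set v | exists (n : nat) (a : 'I_n -> R[i]) (e : 'I_n -> H),
     (forall i, E (e i)) /\ v = \sum_(i < n) a i *: e i].

End Operators.

Section InnerProduct.
Context {R : realType} {H : normedModType R[i]}.
Variable ip : {dot H for Num.conj}.
Implicit Types (A : operator H) (T : H -> H).

(** [A^*], single-valued when [op_dom A] is dense. *)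
Definition adjoint_op A : operator H :=
  let adj y z := forall x, op_dom A x -> ip (A x) y = ip x z in
  {| op_dom := [set y | exists z, adj y z];
     op_fun := fun y => xget 0 [set z | adj y z] |}.

Definition symmetric_op A : Prop :=
  dense (op_dom A) /\
  forall x y, op_dom A x -> op_dom A y -> ip (A x) y = ip x (A y).

Definition selfadjoint_op A : Prop :=
  dense (op_dom A) /\ op_eq A (adjoint_op A).

Definition nonneg_op T : Prop := forall x, 0 <= ip (T x) x.

Definition orthonormal_basis (E : set H) : Prop :=
  (forall x y, E x -> E y -> ip x y = (x == y)%:R) /\
  closure (lin_span E) = setT.

Definition riesz_basis (B : set H) : Prop :=
  exists (E : set H) (T : H -> H),
    [/\ orthonormal_basis E, bounded_linear T, invertible T & B = T @` E].

End InnerProduct.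

(* Main.v *)
Require Import Defs.
From mathcomp Require Import all_boot all_order all_algebra.
From mathcomp Require Import complex.
From mathcomp Require Import all_classical all_reals all_analysis.
From mathcomp Require Import ring lra.
Import Order.TTheory GRing.Theory Num.Theory.
Import numFieldNormedType.Exports.

(** Write [G] for the inverse of [L] and [S] for [I + KL].  On the range of [G]
    the operator [KL] acts as [K L], so [S G f = G f + K f]: the inverse of
    [LK] is the product [S G] of a positive invertible operator and a compact
    self-adjoint one.  If [T] is a self-adjoint square root of [S], then
    [T^-1 (S G) T = T G T =: M] is compact, self-adjoint and injective.  The
    spectral theorem gives an orthonormal basis [E] of eigenvectors of [M],
    and [T E] is a Riesz basis of eigenvectors of [S G], with nonzero
    eigenvalues, hence of eigenvectors of [LK].

    Three points need an argument.

    - The value of the closure [KL] at a point of the domain of [L] must be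
      shown to be unique ([closure_comp_op]).  If [(x, y)] is in the closure of
      the graph of [K L], then [(y, z) = (x, L K^* z)] for every [z], because
      [K^* z] lies in the domain of [L].  That [K^*] is defined everywhere is
      the Riesz representation theorem ([riesz]), which rests on orthogonal
      projection ([orth_proj]).

    - [S] is linear, being the inverse of a linear bijection, and a nonnegative
      operator on a complex space is symmetric ([nonneg_symmetric]).  Being
      symmetric and everywhere defined it is bounded ([hellinger_toeplitz],
      through a gliding hump argument), and being invertible it is bounded
      below.  So [A = I - S / c] has norm less than 1 for a large constant [c],
      and [Z = (A + Z^2) / 2] has a solution which is a limit of a geometrically
      convergent iteration; then [(I - Z)^2 = I - A = S / c]
      ([positive_sqrt]).

    - For the spectral theorem ([compact_symmetric_eigenbasis]), a maximal
      orthonormal set of eigenvectors is total: otherwise its orthogonal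
      complement is a nonzero invariant subspace, on which a vector almost
      attaining the norm of [M] is almost an eigenvector of [M^2], and
      compactness produces an eigenvector
      ([compact_symmetric_eigenvector]).

    Norms take values in [R[i]], which is only partially ordered; estimates
    are therefore made with the real number [rnorm x] and the real part
    [re_ip] of the inner product. *)

Local Open Scope classical_set_scope.
Local Open Scope complex_scope.
Local Open Scope ring_scope.

Set Implicit Arguments.
Unset Strict Implicit.
Unset Printing Implicit Defensive.

(** * Real-valued norm and inner product *)

Section RealNorm.
Context {R : realType} {H : completeNormedModType R[i]}.
Implicit Types (x y z u v w : H) (S T : H -> H).

Lemma lin0 T : linear T -> T 0 = 0.
Proof. by move=> lT; rewrite -[X in T X](subrr 0) -scaleN1r addrC lT scaleN1r addNr. Qed.

Definition rnorm x : R := complex.Re `|x|.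
Lemma rnormE x : `|x| = (rnorm x)%:C.
Proof. by rewrite /rnorm RRe_real// ger0_real. Qed.
Lemma rnorm_ge0 x : 0 <= rnorm x.
Proof. by rewrite -ler0c -rnormE. Qed.
Lemma rnorm_eq0 x : rnorm x = 0 -> x = 0.
Proof. by move=> h; apply/eqP; rewrite -normr_eq0 rnormE h. Qed.
Lemma rnorm0 : rnorm 0 = 0.
Proof. by rewrite /rnorm normr0. Qed.
Lemma rnorm_gt0 x : x <> 0 -> 0 < rnorm x.
Proof. by move=> x0; rewrite lt_neqAle rnorm_ge0 andbT eq_sym; apply/eqP => /rnorm_eq0. Qed.
Lemma rnormN x : rnorm (- x) = rnorm x.
Proof. by rewrite /rnorm normrN. Qed.
Lemma ler_rnormD x y : rnorm (x + y) <= rnorm x + rnorm y.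
Proof. by rewrite -lecR rmorphD /= -!rnormE ler_normD. Qed.
Lemma rnormZ (a : R[i]) x : rnorm (a *: x) = complex.Re `|a| * rnorm x.
Proof.
apply: (@complexI R); rewrite -rnormE normrZ rnormE -[`|a|]RRe_real ?ger0_real//.
by rewrite -rmorphM.
Qed.
Lemma rnormZ_real (a : R) x : rnorm (a%:C *: x) = `|a| * rnorm x.
Proof.
by rewrite rnormZ normc_def /= expr0n addr0 sqrtr_sqr.
Qed.

Lemma linD T x y : linear T -> T (x + y) = T x + T y.
Proof. by move=> lT; rewrite -[x in T (x + _)]scale1r lT scale1r. Qed.
Lemma linZ T (a : R[i]) x : linear T -> T (a *: x) = a *: T x.
Proof. by move=> lT; rewrite -[a *: x]addr0 lT (lin0 lT) addr0. Qed.
Lemma linN T x : linear T -> T (- x) = - T x.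
Proof. by move=> lT; rewrite -scaleN1r linZ// scaleN1r. Qed.
Lemma linB T x y : linear T -> T (x - y) = T x - T y.
Proof. by move=> lT; rewrite linD// linN. Qed.

Lemma discriminant_le (a b c : R) : 0 <= c ->
  (forall t, 0 <= a + 2 * t * b + t ^+ 2 * c) -> b ^+ 2 <= a * c.
Proof.
move=> c0 h; have [c_eq0|c_neq0] := eqVneq c 0.
  have [->|b_neq0] := eqVneq b 0; first by rewrite c_eq0 mulr0 expr0n.
  have := h (- (a + 1) / (2 * b)); rewrite c_eq0 mulr0 addr0.
  rewrite (_ : 2 * _ * b = - (a + 1)); first by lra.
  by field.
have c_gt0 : 0 < c by rewrite lt_neqAle eq_sym c_neq0.
have := h (- b / c).
rewrite (_ : _ + _ = (a * c - b ^+ 2) / c); last by field.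
by rewrite pmulr_lge0 ?invr_gt0// subr_ge0.
Qed.

Definition re_ip (ip : {dot H for Num.conj}) x y : R := complex.Re (ip x y).

Section InnerProductNorm.
Variable ip : {dot H for Num.conj}.
Hypothesis hn : hilbert_norm ip.
Local Notation rdot := (re_ip ip).

Lemma Re_conj (a : R[i]) : complex.Re (Num.conj a) = complex.Re a.
Proof. by case: a. Qed.
Lemma ipC x y : ip x y = Num.conj (ip y x).
Proof. by rewrite hermC /= expr0 mul1r. Qed.
Lemma rdotC x y : rdot x y = rdot y x.
Proof. by rewrite /re_ip ipC Re_conj. Qed.
Lemma rdotDl x y z : rdot (x + y) z = rdot x z + rdot y z.
Proof. by rewrite /re_ip linearDl raddfD. Qed.
Lemma rdotNl x z : rdot (- x) z = - rdot x z.
Proof. by rewrite /re_ip linearNl raddfN. Qed.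
Lemma rdotZl (a : R) x z : rdot (a%:C *: x) z = a * rdot x z.
Proof. by rewrite /re_ip linearZl_LR /=; case: (ip x z) => b c /=; rewrite mul0r subr0. Qed.
Lemma rdotxx x : rdot x x = rnorm x ^+ 2.
Proof. by rewrite /re_ip -hn rnormE -rmorphXn. Qed.
Lemma ipZl a x z : ip (a *: x) z = a * ip x z.
Proof. by rewrite linearZl_LR. Qed.
Lemma ipZr a x z : ip x (a *: z) = Num.conj a * ip x z.
Proof. by rewrite linearZr_LR. Qed.
Lemma ipDl x y z : ip (x + y) z = ip x z + ip y z.
Proof. exact: linearDl. Qed.
Lemma ipBl x y z : ip (x - y) z = ip x z - ip y z.
Proof. exact: linearBl. Qed.
Lemma ipBr x y z : ip x (y - z) = ip x y - ip x z.
Proof. exact: linearBr. Qed.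
(** The imaginary part of [ip x y] is minus the real part of [ip ('i x) y]. *)
Lemma ip_eq0 x y : rdot x y = 0 -> rdot ('i%C *: x) y = 0 -> ip x y = 0.
Proof.
rewrite /re_ip ipZl; case: (ip x y) => a b /= -> /eqP.
by rewrite mul0r mul1r sub0r oppr_eq0 => /eqP ->.
Qed.
Lemma rdotDr x y z : rdot x (y + z) = rdot x y + rdot x z.
Proof. by rewrite rdotC rdotDl !(rdotC x). Qed.
Lemma rdotNr x y : rdot x (- y) = - rdot x y.
Proof. by rewrite rdotC rdotNl rdotC. Qed.
Lemma rdotZr (a : R) x y : rdot x (a%:C *: y) = a * rdot x y.
Proof. by rewrite rdotC rdotZl rdotC. Qed.

Lemma rnorm_sqD x y : rnorm (x + y) ^+ 2 = rnorm x ^+ 2 + 2 * rdot x y + rnorm y ^+ 2.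
Proof. by rewrite -!rdotxx !rdotDl !rdotDr (rdotC y x); ring. Qed.
Lemma rnorm_sqB x y : rnorm (x - y) ^+ 2 = rnorm x ^+ 2 - 2 * rdot x y + rnorm y ^+ 2.
Proof. by rewrite rnorm_sqD rdotNr rnormN; ring. Qed.
Lemma parallelogram x y :
  rnorm (x + y) ^+ 2 + rnorm (x - y) ^+ 2 = 2 * (rnorm x ^+ 2 + rnorm y ^+ 2).
Proof. by rewrite rnorm_sqD rnorm_sqB; ring. Qed.

Definition symmetric_map S := forall x y, ip (S x) y = ip x (S y).
Lemma symmetric_rdot S x y : symmetric_map S -> rdot (S x) y = rdot x (S y).
Proof. by move=> sS; rewrite /re_ip sS. Qed.

(** The form [(x, y) |-> rdot (S x) y] is symmetric and nonnegative but may be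
    degenerate, so the inequality comes from the discriminant of
    [t |-> rdot (S (x + t y)) (x + t y)], without dividing by a value of the
    form. *)
Lemma form_CauchySchwarz S x y : linear S -> symmetric_map S ->
  (forall z, 0 <= rdot (S z) z) -> rdot (S x) y ^+ 2 <= rdot (S x) x * rdot (S y) y.
Proof.
move=> lS sS S0; apply: discriminant_le => // t.
have := S0 (x + t%:C *: y).
rewrite linD// linZ// !rdotDl !rdotDr !rdotZl !rdotZr (symmetric_rdot y x sS) (rdotC y).
by move/le_trans; apply; rewrite le_eqVlt; apply/orP; left; apply/eqP; ring.
Qed.

Lemma rdot_le x y : `|rdot x y| <= rnorm x * rnorm y.
Proof.
have h : rdot x y ^+ 2 <= (rnorm x * rnorm y) ^+ 2.
  rewrite exprMn -!rdotxx; apply: (@form_CauchySchwarz id) => //.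
  by move=> z; rewrite rdotxx sqr_ge0.
by rewrite -[leRHS]ger0_norm ?mulr_ge0 ?rnorm_ge0// -ler_sqr ?nnegrE// !real_normK ?num_real.
Qed.

(** The one place where completeness of [H] enters: an explicit real bound on
    the tails makes the limit come with an error estimate. *)
Lemma cauchy_bound_cvg (s : nat -> H) (b : nat -> R) :
  (forall n m, (n <= m)%N -> rnorm (s m - s n) <= b n) ->
  (forall e, 0 < e -> exists n, b n < e) ->
  exists l, forall n, rnorm (l - s n) <= b n.
Proof.
move=> hs hb.
have cs : cvg (s @ \oo).
  apply/cauchy_cvgP/cauchy_exP => e e0.
  have e_real : e = (complex.Re e)%:C by rewrite RRe_real// gtr0_real.
  have [n hbn] : exists n, b n < complex.Re e.
    by apply: hb; rewrite -ltcR -e_real.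
  exists (s n), n => // m /= le_nm; rewrite -ball_normE /= distrC rnormE e_real ltcR.
  exact: le_lt_trans (hs _ _ le_nm) hbn.
exists (lim (s @ \oo)) => n.
apply/ler_addgt0Pr => e e0.
have /cvgrPdist_lt/(_ e%:C) := cs.
rewrite ltcR => /(_ e0)[N _ hN].
have := hN (maxn N n) (leq_maxl _ _); rewrite rnormE ltcR => hl.
rewrite -(subrKA (s (maxn N n))) (le_trans (ler_rnormD _ _))// addrC lerD//.
  by apply: hs; rewrite leq_maxr.
exact: ltW.
Qed.

Lemma closure_rnormP (A : set H) x :
  closure A x <-> forall e, 0 < e -> exists2 y, A y & rnorm (x - y) < e.
Proof.
split=> [cA e e0|h B /nbhs_ballP[e /= e0 eB]].
  have [|y [Ay]] := cA (ball x e%:C); first by apply: nbhsx_ballx; rewrite ltcR.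
  by rewrite -ball_normE /= rnormE ltcR => xy; exists y.
have e_real : e = (complex.Re e)%:C by rewrite RRe_real// gtr0_real.
have [|y Ay xy] := h (complex.Re e); first by rewrite -ltcR -e_real.
by exists y; split=> //; apply: eB; rewrite -ball_normE /= rnormE e_real ltcR.
Qed.

Lemma rnorm_small x C : (forall e, 0 < e -> rnorm x <= C * e) -> x = 0.
Proof.
move=> h; apply: rnorm_eq0; apply/eqP; rewrite eq_le rnorm_ge0 andbT.
have C0 : 0 <= C by rewrite -[C]mulr1; exact: le_trans (rnorm_ge0 x) (h 1 ltr01).
apply/ler_addgt0Pr => e e0; rewrite add0r.
have := h (e / (C + 1)); rewrite divr_gt0 ?ltr_wpDl// => /(_ isT)/le_trans; apply.
by rewrite mulrCA ler_piMr ?(ltW e0)// ler_pdivrMr ?ltr_wpDl// mul1r; lra.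
Qed.
End InnerProductNorm.
End RealNorm.

(** * Orthogonal projection and Riesz representation *)

Section Projection.
Context {R : realType} {H : completeNormedModType R[i]}.
Implicit Types (x y z u v w : H) (T S : H -> H) (W : set H).

Definition lin_subspace W := W 0 /\ forall (a : R[i]) u v, W u -> W v -> W (a *: u + v).

Lemma lin_subspaceZ W (a : R[i]) u : lin_subspace W -> W u -> W (a *: u).
Proof. by move=> [W0 Wl] Wu; rewrite -[_ *: _]addr0; exact: Wl. Qed.
Lemma lin_subspaceD W u v : lin_subspace W -> W u -> W v -> W (u + v).
Proof. by move=> [W0 Wl] Wu Wv; rewrite -[u]scale1r; exact: Wl. Qed.

Lemma sqrt_invn_small (e : R) : 0 < e -> exists n, Num.sqrt n.+1%:R^-1 < e.
Proof.
move=> e0; have e2 : 0 < e ^+ 2 by rewrite exprn_gt0.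
exists (Num.truncn (e ^+ 2)^-1); rewrite -[ltRHS](ger0_norm (ltW e0)) -sqrtr_sqr ltr_sqrt//.
by rewrite -ltf_pV2 ?posrE ?invr_gt0// invrK truncnS_gt.
Qed.

Section OrthogonalProjection.
Variable ip : {dot H for Num.conj}.
Hypothesis hn : hilbert_norm ip.
Local Notation rdot := (re_ip ip).

(** A minimizing sequence for the distance from [x] to [W] is Cauchy by the
    parallelogram law; its limit [w] lies in the closure of [W] only, but
    orthogonality to [W] passes to the limit, so [W] need not be closed. *)
Lemma orth_proj W x : lin_subspace W ->
  exists2 w, closure W w & forall v, W v -> ip (x - w) v = 0.
Proof.
move=> sW; pose D := [set rnorm (x - w) ^+ 2 | w in W].
have hD : has_inf D.
  split; first by exists (rnorm (x - 0) ^+ 2), 0 => //; case: sW.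
  by exists 0 => _ [w _ <-]; rewrite sqr_ge0.
pose d := inf D.
have d_le w : W w -> d <= rnorm (x - w) ^+ 2 by move=> Ww; apply: inf_lbound; [case: hD|exists w].
pose r (n : nat) : R := Num.sqrt n.+1%:R^-1.
have rE n : r n ^+ 2 = n.+1%:R^-1 by rewrite sqr_sqrtr.
have r0 n : 0 <= r n by exact: sqrtr_ge0.
have /choice[s hs] n : exists w, W w /\ rnorm (x - w) ^+ 2 < d + r n ^+ 2.
  have [|_ [w Ww <-] hw] := @inf_adherent _ D (r n ^+ 2) _ hD.
    by rewrite rE invr_gt0.
  by exists w.
have [w hw] : exists w, forall n, rnorm (w - s n) <= 2 * r n.
  apply: cauchy_bound_cvg => [n m le_nm|e e0]; last first.
    have [n hn_] := sqrt_invn_small (divr_gt0 e0 (ltr0n R 2)).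
    by exists n; rewrite mulrC -ltr_pdivlMr.
  rewrite -ler_sqr ?nnegrE ?rnorm_ge0 ?mulr_ge0//.
  have [Wn hn_] := hs n; have [Wm hm_] := hs m.
  have := parallelogram hn (x - s n) (x - s m).
  rewrite (_ : _ - _ - _ = s m - s n); last first.
    by rewrite opprB addrC addrA subrK.
  have := d_le (2^-1%:C *: (s n + s m)).
  move/(_ (lin_subspaceZ _ sW (lin_subspaceD sW Wn Wm))).
  have -> : x - s n + (x - s m) = 2%:C *: (x - 2^-1%:C *: (s n + s m)).
    rewrite scalerBr scalerA -rmorphM divff// rmorph1 scale1r.
    by rewrite -[2]/(1 + 1) rmorphD rmorph1 scalerDl scale1r opprD addrACA.
  rewrite rnormZ_real ger0_norm// exprMn.
  have rmn : r m ^+ 2 <= r n ^+ 2.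
    by rewrite !rE lef_pV2 ?posrE// ler_nat.
  rewrite exprMn; move: (rnorm _ ^+ 2) (rnorm _ ^+ 2) hn_ hm_ => p q; lra.
exists w.
  apply/closure_rnormP => e e0; have [n hn_] := sqrt_invn_small (divr_gt0 e0 (ltr0n R 2)).
  exists (s n); first by case: (hs n).
  by apply: le_lt_trans (hw n) _; rewrite mulrC -ltr_pdivlMr.
have re_orth v : W v -> rdot (x - w) v = 0.
  move=> Wv.
  (* [x - s n] is within [r n ^+ 2] of the squared distance to [W], so moving
     by a multiple of [v] gains at most that much *)
  have hb n : `|rdot (x - s n) v| <= r n * rnorm v.
    rewrite -ler_sqr ?nnegrE ?mulr_ge0 ?rnorm_ge0// real_normK ?num_real// exprMn.
    have [Wn hn_] := hs n.
    apply: discriminant_le => [|t]; first exact: sqr_ge0.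
    have := d_le (- t%:C *: v + s n).
    move/(_ (proj2 sW _ _ _ Wv Wn)).
    rewrite scaleNr opprD opprK addrCA addrC (rnorm_sqD hn) rdotZr rnormZ_real exprMn.
    by rewrite real_normK ?num_real//; move: hn_; lra.
  have : forall e, 0 < e -> `|rdot (x - w) v| <= 3 * rnorm v * e.
    move=> e /sqrt_invn_small[n rn].
    have -> : x - w = (x - s n) - (w - s n) by rewrite opprB addrA subrK.
    rewrite rdotDl rdotNl.
    apply: le_trans (ler_normB _ _) _.
    have h1 := hb n; have h2 := le_trans (rdot_le hn (w - s n) v) (ler_wpM2r (rnorm_ge0 v) (hw n)).
    have h3 : r n * rnorm v <= e * rnorm v by rewrite ler_wpM2r ?rnorm_ge0// ltW.
    by move: h1 h2 h3; rewrite -/(r n); lra.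
  move=> small; apply/eqP; rewrite -normr_le0; apply/ler_addgt0Pr => e e0.
  have p : 0 < 3 * rnorm v + 1 by have := rnorm_ge0 v; lra.
  apply: le_trans (small (e / (3 * rnorm v + 1)) _) _; first exact: divr_gt0.
  by rewrite add0r mulrCA ler_piMr ?(ltW e0)// ler_pdivrMr// mul1r; lra.
move=> v Wv; apply: ip_eq0; first exact: re_orth.
rewrite -[rdot _ _]/(complex.Re _) ipZl.
have := re_orth _ (lin_subspaceZ (Num.conj ('i%C : R[i])) sW Wv).
by rewrite -[rdot _ _]/(complex.Re _) ipZr conjCK.
Qed.

Lemma ipxx_eq0 x : ip x x = 0 -> x = 0.
Proof. by move=> /eqP; rewrite dnorm_eq0 => /eqP. Qed.

Lemma norm_ip_le x y : `|ip x y| <= ((rnorm x * rnorm y)%:C : R[i]).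
Proof.
have [->|h] := eqVneq (ip x y) 0; first by rewrite normr0 ler0c mulr_ge0 ?rnorm_ge0.
(* multiplying [x] by a phase makes the inner product real *)
pose a := `|ip x y| / ip x y.
have na : `|a| = 1 by rewrite /a normrM normfV normr_id divff// normr_eq0.
have e : ip (a *: x) y = `|ip x y| by rewrite ipZl divfK.
have -> : `|ip x y| = (rdot (a *: x) y)%:C.
  by rewrite -[rdot _ _]/(complex.Re _) e RRe_real// ger0_real.
rewrite lecR; apply: le_trans (ler_norm _) _; apply: le_trans (rdot_le hn _ _) _.
by rewrite rnormZ na /= mul1r.
Qed.

Lemma closure_kernel (f : H -> R[i]) (C : R) w :
  (forall x y, f (x - y) = f x - f y) ->
  (forall x, complex.Re `|f x| <= C * rnorm x) ->
  closure [set x | f x = 0] w -> f w = 0.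
Proof.
move=> fB hf /closure_rnormP cw.
apply/eqP; rewrite -normr_le0 -[`|_|]RRe_real ?ger0_real// (lecR _ 0).
apply/ler_addgt0Pr => e e0; rewrite add0r.
pose C' := `|C| + 1; have C'0 : 0 < C' by rewrite ltr_wpDl.
have [y fy wy] := cw _ (divr_gt0 e0 C'0).
have -> : f w = f (w - y) by rewrite fB fy subr0.
apply: le_trans (hf _) _; apply: le_trans (_ : C' * rnorm (w - y) <= _).
  by rewrite ler_wpM2r ?rnorm_ge0// (le_trans (ler_norm _))// lerDl.
by rewrite mulrC -ler_pdivlMr// ltW.
Qed.

(** A vector [e] orthogonal to the kernel of [f] represents [f] up to a scalar,
    because [f e *: x - f x *: e] is in the kernel. *)
Lemma riesz (f : H -> R[i]) (C : R) :
  (forall a x y, f (a *: x + y) = a * f x + f y) ->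
  (forall x, complex.Re `|f x| <= C * rnorm x) ->
  exists z, forall x, f x = ip x z.
Proof.
move=> fl fb.
have f0 : f 0 = 0.
  by have := fl (-1) 0 0; rewrite scaler0 addr0 mulN1r addNr.
have fD x y : f (x + y) = f x + f y by rewrite -[in LHS](scale1r x) fl mul1r.
have fZ a x : f (a *: x) = a * f x by rewrite -[_ *: _]addr0 fl f0 addr0.
have fB x y : f (x - y) = f x - f y by rewrite fD -scaleN1r fZ mulN1r.
have [h|/existsNP[x0 fx0]] := pselect (forall x, f x = 0).
  by exists 0 => x; rewrite h linear0r.
have sW : lin_subspace [set x | f x = 0].
  by split=> //= a u v fu fv; rewrite fl fu fv mulr0 addr0.
have [w /(closure_kernel fB fb) fw ortho] := orth_proj x0 sW.
pose e := x0 - w; have fe : f e = f x0 by rewrite fB fw subr0.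
have e0 : ip e e != 0.
  apply/eqP => /ipxx_eq0 eq0; apply: fx0; rewrite -fe eq0; exact: f0.
exists ((Num.conj (f e) / Num.conj (ip e e)) *: e) => x.
rewrite ipZr rmorphM fmorphV /= !conjCK.
have ker : f (f e *: x - f x *: e) = 0 by rewrite fB !fZ (mulrC (f x)) subrr.
have := ortho _ ker.
rewrite -/e ipC linearBl => /eqP; rewrite conjC_eq0 subr_eq0 !linearZl_LR /= => /eqP h.
by rewrite -[_ *: _]/(f e * ((ip e e)^-1 * ip x e)) mulrA mulrAC h mulfK.
Qed.
End OrthogonalProjection.
End Projection.

(** * Boundedness of symmetric operators and square roots *)

Section Symmetric.
Context {R : realType} {H : completeNormedModType R[i]}.
Implicit Types (x y z u v w : H) (T S : H -> H) (W : set H).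

Lemma geometric_small (q C e : R) : 0 <= q < 1 -> 0 < e -> exists n, C * q ^+ n < e.
Proof.
move=> /andP[q0 q1] e0.
have /cvgrPdist_lt/(_ (e / (`|C| + 1))) : (fun n => q ^+ n) @ \oo --> (0 : R).
  by apply: cvg_expr; rewrite ger0_norm.
have C0 : 0 < `|C| + 1 by rewrite ltr_wpDl.
rewrite divr_gt0// => /(_ isT)[N _ /(_ N (leqnn _))].
rewrite /= sub0r normrN ger0_norm ?exprn_ge0// ltr_pdivlMr// mulrC => h.
exists N; apply: le_lt_trans h; rewrite ler_wpM2r ?exprn_ge0//.
by rewrite (le_trans (ler_norm _))// lerDl.
Qed.

Lemma geometric_eq0 (q C a : R) : 0 <= q < 1 -> (forall n, `|a| <= C * q ^+ n) -> a = 0.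
Proof.
move=> q01 h; apply/eqP; rewrite -normr_le0; apply/ler_addgt0Pr => e e0.
have [n hn] := geometric_small C q01 e0.
by rewrite add0r (le_trans (h n))// ltW.
Qed.

Lemma geometric_rnorm_eq0 (q C : R) x : 0 <= q < 1 -> (forall n, rnorm x <= C * q ^+ n) -> x = 0.
Proof.
move=> q01 h; apply/rnorm_eq0/(geometric_eq0 q01 (C := C)) => n.
by rewrite ger0_norm ?rnorm_ge0.
Qed.

Lemma geometric_limit (q C : R) (s : nat -> H) : 0 <= q < 1 ->
  (forall n, rnorm (s n.+1 - s n) <= C * q ^+ n) ->
  exists l, forall n, rnorm (l - s n) <= C / (1 - q) * q ^+ n.
Proof.
move=> q01 hs; have [q0 q1] := andP q01.
have q1' : 0 < 1 - q by rewrite subr_gt0.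
apply: cauchy_bound_cvg => [n m|e]; last exact: geometric_small.
move=> /subnKC <-; move: (m - n)%N => {m} k.
have C0 : 0 <= C by have := le_trans (rnorm_ge0 _) (hs 0%N); rewrite mulr1.
suff : rnorm (s (n + k)%N - s n) <= C / (1 - q) * (q ^+ n - q ^+ (n + k)).
  move/le_trans; apply; rewrite ler_wpM2l ?divr_ge0 ?(ltW q1')//.
  by rewrite gerBl exprn_ge0.
elim: k => [|k ih]; first by rewrite addn0 !subrr rnorm0 mulr0.
rewrite addnS -(subrKA (s (n + k)%N)) (le_trans (ler_rnormD _ _))//.
have -> : C / (1 - q) * (q ^+ n - q ^+ (n + k).+1) =
    C * q ^+ (n + k) + C / (1 - q) * (q ^+ n - q ^+ (n + k)).
  by rewrite exprS; field; lra.
by rewrite lerD.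
Qed.

Section SymmetricOperators.
Variable ip : {dot H for Num.conj}.
Hypothesis hn : hilbert_norm ip.
Local Notation rdot := (re_ip ip).

Lemma conjR (a : R) : Num.conj (a%:C : R[i]) = a%:C.
Proof. exact: conjc_real. Qed.

(** Complex polarization: the form of [S] is real at [x + y] and at
    ['i x + y], which gives the imaginary and the real part of the identity. *)
Lemma nonneg_symmetric S : linear S -> nonneg_op ip S -> symmetric_map ip S.
Proof.
move=> lS S0 x y.
have Im0 u : complex.Im (ip (S u) u) = 0 by apply: ger0_Im.
have := Im0 (x + y); rewrite linD// linearDl !linearDr /=.
rewrite !raddfD /= !Im0 add0r addr0 => h1.
have := Im0 ('i%C *: x + y); rewrite lS linearDl !linearDr /= !ipZl !ipZr.
rewrite [ip x _]ipC.
have := Im0 x; have := Im0 y.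
move: h1; case: (ip (S x) y) => a b; case: (ip (S y) x) => c d.
case: (ip (S y) y) => ? ?; case: (ip (S x) x) => ? ? /= h1 -> -> h2.
by apply/eqP; rewrite eq_complex /=; apply/andP; split; apply/eqP; lra.
Qed.

(** Complex linearity recovers the imaginary parts from the real ones. *)
Lemma symmetricP S : linear S -> (forall x y, rdot (S x) y = rdot x (S y)) -> symmetric_map ip S.
Proof.
move=> lS h x y; apply/eqP; rewrite -subr_eq0; apply/eqP.
have e u : complex.Re (ip (S u) y - ip u (S y)) = 0.
  by rewrite raddfB /= -[complex.Re _]/(rdot _ _) h subrr.
have := e ('i%C *: x); have := e x; rewrite linZ// !ipZl -mulrBr.
case: (_ - _) => a b /= -> /eqP; rewrite mul0r mul1r sub0r oppr_eq0 => /eqP -> //.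
Qed.

(** Uniform boundedness principle, by a gliding hump: [s n.+1] differs from [s n]
    by a vector of norm at most [3 ^- n] along [z n], with the sign that avoids
    cancellation, so that [rdot (s n.+1) (z n)] is at least
    [3 ^- n * rnorm (z n)]; the later steps add up to at most [3 ^- n / 2] and
    spoil at most half of it. *)
Lemma uniform_boundedness (z : nat -> H) :
  (forall n, n%:R * 3 ^+ n <= rnorm (z n)) ->
  ~ (forall x, exists C : R, forall n, `|rdot x (z n)| <= C).
Proof.
move=> zbig bnd.
pose y n := (3^-1 ^+ n / rnorm (z n))%:C *: z n.
pose s := fix s n := if n is k.+1 then
  (if 0 <= rdot (s k) (z k) then s k + y k else s k - y k) else 0.
have q01 : 0 <= (3^-1 : R) < 1 by lra.
have ny n : rnorm (y n) <= 3^-1 ^+ n.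
  rewrite rnormZ_real ger0_norm ?divr_ge0 ?exprn_ge0 ?rnorm_ge0//.
  have [->|h] := eqVneq (rnorm (z n)) 0; first by rewrite mulr0 exprn_ge0.
  by rewrite divfK.
have rpy n : rdot (y n) (z n) = 3^-1 ^+ n * rnorm (z n).
  rewrite rdotZl (rdotxx hn); have [->|h] := eqVneq (rnorm (z n)) 0; first by rewrite expr0n !mulr0.
  by field.
have [|l hl] := geometric_limit (C := 1) (s := s) q01.
  move=> n /=; rewrite mul1r; case: ifP => _; rewrite addrAC subrr add0r ?rnormN//.
have [C hC] := bnd l.
have big n : n%:R / 2 <= C.
  apply: le_trans (hC n).
  have h1 : 3^-1 ^+ n * rnorm (z n) <= `|rdot (s n.+1) (z n)|.
    have p : 0 <= 3^-1 ^+ n * rnorm (z n) by rewrite mulr_ge0 ?exprn_ge0 ?rnorm_ge0.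
    rewrite /=; case: ifPn => [h|]; rewrite ?rdotDl ?rdotNl rpy.
      by rewrite ger0_norm ?addr_ge0// lerDr.
    rewrite -ltNge => h; rewrite ler0_norm ?opprB ?lerBlDr ?lerDl ?oppr_ge0; lra.
  (* the later steps add up to [3^-1 / (1 - 3^-1) = 2^-1] times [3 ^- n] *)
  have h2 : `|rdot (l - s n.+1) (z n)| <= 2^-1 * (3^-1 ^+ n * rnorm (z n)).
    apply: le_trans (rdot_le hn _ _) _; rewrite mulrA ler_wpM2r ?rnorm_ge0//.
    apply: le_trans (hl n.+1) _; rewrite exprS mulrA ler_wpM2r ?exprn_ge0//.
    by rewrite (_ : 1 / (1 - 3^-1) * 3^-1 = 2^-1 :> R)//; field; lra.
  have h3 : n%:R <= 3^-1 ^+ n * rnorm (z n).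
    by rewrite exprVn mulrC ler_pdivlMr ?exprn_gt0.
  have : rdot (s n.+1) (z n) = rdot l (z n) - rdot (l - s n.+1) (z n).
    by rewrite rdotDl rdotNl; ring.
  move=> e; rewrite e in h1.
  have := le_trans h1 (ler_normB _ _); move: h2 h3; move: (_ * rnorm (z n)) => p; lra.
have := big (Num.truncn (2 * C)).+1.
have := truncnS_gt (2 * C); lra.
Qed.

(** If [S] is unbounded, some [S (y n)] with [y n] in the unit ball grow faster
    than [n * 3 ^ n], while their inner products with [x] are bounded by
    [rnorm (S x)], by symmetry. *)
Lemma hellinger_toeplitz S : linear S -> symmetric_map ip S ->
  exists C : R, forall x, rnorm (S x) <= C * rnorm x.
Proof.
move=> lS sS; apply: contrapT => /forallNP nb.
have /choice[y hy] n : exists y, rnorm y <= 1 /\ n%:R * 3 ^+ n <= rnorm (S y).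
  have /existsNP[x /negP] := nb (n%:R * 3 ^+ n); rewrite -ltNge => hx.
  have x0 : 0 < rnorm x.
    rewrite lt_neqAle rnorm_ge0 eq_sym andbT; apply/eqP => x0; move: hx.
    by rewrite (rnorm_eq0 x0) (lin0 lS) rnorm0 mulr0 ltxx.
  exists ((rnorm x)^-1%:C *: x).
  rewrite linZ// !rnormZ_real ger0_norm ?invr_ge0 ?rnorm_ge0// mulVf ?gt_eqF//.
  by split=> //; rewrite ler_pdivlMl// mulrC ltW.
apply: (@uniform_boundedness (fun n => S (y n))) => [n|x]; first by case: (hy n).
exists (rnorm (S x)) => n; rewrite -symmetric_rdot//; apply: le_trans (rdot_le hn _ _) _.
by rewrite ler_piMr ?rnorm_ge0//; case: (hy n).
Qed.

Section Sqrt.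
Variables (A : H -> H) (q : R).
Hypotheses (lA : linear A) (sA : symmetric_map ip A) (q01 : 0 <= q < 1).
Hypothesis nA : forall x, rnorm (A x) <= q * rnorm x.

(** Picard iteration for [Z = (A + Z^2) / 2].  On operators of norm at most [q]
    the right-hand side is a contraction of ratio [q], since
    [Y^2 - Z^2 = Y (Y - Z) + (Y - Z) Z].  Limits are taken pointwise. *)
Fixpoint sqrt_iter n x := if n is k.+1 then
  2^-1%:C *: (A x + sqrt_iter k (sqrt_iter k x)) else 0.
Let Y := sqrt_iter.

Let lY n : linear (Y n).
Proof.
elim: n => [a x y|n ih a x y] /=; first by rewrite scaler0 addr0.
rewrite lA !ih !scalerDr !scalerA ![2^-1%:C * a]mulrC.
by rewrite -!addrA; congr (_ + _); rewrite addrCA.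
Qed.

Let sY n : symmetric_map ip (Y n).
Proof.
elim: n => [|n ih] x y /=; first by rewrite linear0l linear0r.
by rewrite ipZl ipZr conjR linearDl linearDr /= sA -!/(Y n) !ih linearDr mulrDr.
Qed.

Let half (u : H) : rnorm (2^-1%:C *: u) = 2^-1 * rnorm u.
Proof. by rewrite rnormZ_real ger0_norm. Qed.

Let nY n x : rnorm (Y n x) <= q * rnorm x.
Proof.
have [q0 q1] := andP q01.
elim: n x => [|n ih] x /=; first by rewrite rnorm0 mulr_ge0 ?rnorm_ge0.
rewrite half -/(Y n).
have h1 := ler_rnormD (A x) (Y n (Y n x)); have h2 := nA x.
have h3 : rnorm (Y n (Y n x)) <= q * rnorm x.
  rewrite (le_trans (ih _))// ler_wpM2l// (le_trans (ih _))//.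
  by rewrite ler_piMl ?rnorm_ge0 ?ltW.
lra.
Qed.

Let dY n x : rnorm (Y n.+1 x - Y n x) <= rnorm x * q ^+ n.
Proof.
have [q0 q1] := andP q01.
elim: n x => [|n ih] x.
  by rewrite subr0 mulr1 (le_trans (nY _ _))// ler_piMl ?rnorm_ge0 ?ltW.
have -> : Y n.+2 x - Y n.+1 x =
    2^-1%:C *: (Y n.+1 (Y n.+1 x - Y n x) + (Y n.+1 (Y n x) - Y n (Y n x))).
  rewrite (linB _ _ (lY n.+1)) addrA subrK -[in LHS]/(2^-1%:C *: (A x + Y n.+1 (Y n.+1 x))).
  rewrite -[X in _ - X]/(2^-1%:C *: (A x + Y n (Y n x))).
  by rewrite -scalerBr opprD addrACA subrr add0r.
rewrite half.
have h1 := ler_rnormD (Y n.+1 (Y n.+1 x - Y n x)) (Y n.+1 (Y n x) - Y n (Y n x)).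
have h2 := le_trans (nY n.+1 _) (ler_wpM2l q0 (ih x)).
have h3 := le_trans (ih (Y n x)) (ler_wpM2r (exprn_ge0 n q0) (nY n x)).
rewrite exprS; lra.
Qed.

(** The last conclusion says that [(I - Z)^2 = I - A]. *)
Lemma sqrt_fixpoint : exists Z : H -> H, [/\ linear Z, symmetric_map ip Z,
  exists C : R, forall x, rnorm (Z x) <= C * rnorm x &
  forall x, Z x + Z x = A x + Z (Z x)].
Proof.
have [q0 q1] := andP q01.
have /choice[Z hZ] x : exists l, forall n, rnorm (l - Y n x) <= rnorm x / (1 - q) * q ^+ n.
  exact: geometric_limit (fun n => dY n x).
have lZ : linear Z.
  move=> a x y; apply/eqP; rewrite -subr_eq0; apply/eqP.
  apply: (geometric_rnorm_eq0 q01 (C := (rnorm (a *: x + y) / (1 - q) +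
    (complex.Re `|a| * (rnorm x / (1 - q)) + rnorm y / (1 - q))))) => n.
  have -> : Z (a *: x + y) - (a *: Z x + Z y) =
      (Z (a *: x + y) - Y n (a *: x + y)) - (a *: (Z x - Y n x) + (Z y - Y n y)).
    by rewrite lY scalerBr addrACA -opprD opprB addrA subrK.
  have h1 := hZ (a *: x + y) n.
  have h2 := hZ x n; have h3 := hZ y n.
  have h4 : complex.Re `|a| * rnorm (Z x - Y n x) <= complex.Re `|a| * (rnorm x / (1 - q) * q ^+ n).
    by rewrite ler_wpM2l// -ler0c RRe_real ?ger0_real//.
  have h5 := ler_rnormD (a *: (Z x - Y n x)) (Z y - Y n y); rewrite rnormZ in h5.
  have h6 := ler_rnormD (Z (a *: x + y) - Y n (a *: x + y))
    (- (a *: (Z x - Y n x) + (Z y - Y n y))).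
  rewrite rnormN in h6; move: h1 h2 h3 h4 h5 h6.
  by set t := q ^+ n; rewrite !mulrDl -!mulrA; lra.
exists Z; split=> //.
- apply: symmetricP => // x y; apply/eqP; rewrite -subr_eq0; apply/eqP.
  apply: (geometric_eq0 q01
    (C := (rnorm x / (1 - q) * rnorm y + rnorm x * (rnorm y / (1 - q))))) => n.
  have -> : rdot (Z x) y - rdot x (Z y) = rdot (Z x - Y n x) y - rdot x (Z y - Y n y).
    by rewrite rdotDl rdotDr rdotNl rdotNr (symmetric_rdot _ _ (sY n)); ring.
  have h1 := le_trans (rdot_le hn _ _) (ler_wpM2r (rnorm_ge0 y) (hZ x n)).
  have h2 := le_trans (rdot_le hn _ _) (ler_wpM2l (rnorm_ge0 x) (hZ y n)).
  apply: le_trans (ler_normB _ _) _; move: h1 h2.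
  by move: (q ^+ n) (_^-1) => t r; lra.
- exists (1 - q)^-1 => x; have := hZ x 0; rewrite subr0 mulr1 mulrC => /le_trans; exact.
- move=> x; apply/eqP; rewrite -subr_eq0; apply/eqP.
  apply: (geometric_rnorm_eq0 q01 (C := (2 * (rnorm x / (1 - q)) +
     rnorm (Z x) / (1 - q) + rnorm x / (1 - q)))) => n.
  have -> : Z x + Z x - (A x + Z (Z x)) = (2%:C *: (Z x - Y n.+1 x)) -
     ((Z (Z x) - Y n (Z x)) + Y n (Z x - Y n x)).
    rewrite (linB _ _ (lY n)) addrA subrK scalerBr.
    rewrite -[Y n.+1 x]/(2^-1%:C *: (A x + Y n (Y n x))) scalerA -rmorphM divff//.
    rewrite rmorph1 scale1r -[2]/(1 + 1) rmorphD rmorph1 scalerDl scale1r.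
    by rewrite -[RHS]addrA -opprD [in RHS]addrACA subrr addr0.
  have h1 := hZ x n.+1; have h2 := hZ (Z x) n; have h3 := hZ x n.
  have h4 := nY n (Z x - Y n x).
  have h5 : q * rnorm (Z x - Y n x) <= rnorm (Z x - Y n x) by rewrite ler_piMl ?rnorm_ge0 ?ltW.
  have h6 := ler_rnormD (Z (Z x) - Y n (Z x)) (Y n (Z x - Y n x)).
  have h7 := ler_rnormD (2%:C *: (Z x - Y n.+1 x)) (- ((Z (Z x) - Y n (Z x)) + Y n (Z x - Y n x))).
  rewrite rnormN rnormZ_real ger0_norm// in h7.
  have h8 : rnorm x / (1 - q) * q ^+ n.+1 <= rnorm x / (1 - q) * q ^+ n.
    rewrite ler_wpM2l ?divr_ge0 ?rnorm_ge0 ?subr_ge0 ?(ltW q1)//.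
    by rewrite exprS ler_piMl ?exprn_ge0 ?(ltW q1).
  move: h1 h2 h3 h4 h5 h6 h7 h8.
  move: (q ^+ n) (q ^+ n.+1) (_^-1) => t t' r; lra.
Qed.
End Sqrt.
(** The norm of a nonnegative operator is bounded by the bound of its form: apply
    the Cauchy-Schwarz inequality of the form to [x] and [A x]. *)
Lemma form_norm_le (A : H -> H) (q : R) : linear A -> symmetric_map ip A ->
  (forall x, 0 <= rdot (A x) x <= q * rnorm x ^+ 2) -> forall x, rnorm (A x) <= q * rnorm x.
Proof.
move=> lA sA hA x.
have [Ax0|Ax0] := eqVneq (rnorm (A x)) 0.
  rewrite Ax0; have /andP[h1 h2] := hA x; have := le_trans h1 h2.
  have [->|x0] := eqVneq (rnorm x) 0; first by rewrite mulr0.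
  have xp : 0 < rnorm x by rewrite lt_neqAle eq_sym x0 rnorm_ge0.
  by rewrite pmulr_lge0 ?exprn_gt0// => q0; rewrite mulr_ge0// ltW.
have Axp : 0 < rnorm (A x) by rewrite lt_neqAle eq_sym Ax0 rnorm_ge0.
have /andP[h1 h2] := hA x; have /andP[h3 h4] := hA (A x).
have q0 : 0 <= q by have := le_trans h3 h4; rewrite pmulr_lge0 ?exprn_gt0.
have := form_CauchySchwarz x (A x) lA sA (fun z => proj1 (andP (hA z))).
rewrite (rdotxx hn) => /le_trans/(_ (ler_pM h1 h3 h2 h4)).
rewrite mulrACA mulrA expr2 ler_pM2r ?exprn_gt0// -expr2 -exprMn.
by rewrite ler_sqr ?nnegrE ?mulr_ge0 ?rnorm_ge0.
Qed.

(** The bounded inverse [P] makes [S] bounded below (this is [lower], from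
    Cauchy-Schwarz for the form of [S] at [P x] and [x]), so that
    [A = I - S / c] satisfies [0 <= A <= q] with [q < 1]; then [I - A] has a square
    root by [sqrt_fixpoint]. *)
Lemma positive_sqrt S P (C D : R) : linear S -> symmetric_map ip S ->
  (forall x, 0 <= rdot (S x) x) -> (forall x, rnorm (S x) <= C * rnorm x) ->
  cancel P S -> (forall x, rnorm (P x) <= D * rnorm x) ->
  exists T, [/\ linear T, symmetric_map ip T,
    exists B : R, forall x, rnorm (T x) <= B * rnorm x & forall x, T (T x) = S x].
Proof.
move=> lS sS S0 nS PK nP.
(* both constants are at least 1, so that [q] below is nonnegative *)
pose c : R := `|C| + 1; pose d : R := `|D| + 1.
have c1 : 1 <= c by rewrite lerDr.
have d1 : 1 <= d by rewrite lerDr.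
have upper x : rdot (S x) x <= c * rnorm x ^+ 2.
  apply: le_trans (ler_norm _) _; apply: le_trans (rdot_le hn _ _) _.
  rewrite expr2 mulrA ler_wpM2r ?rnorm_ge0//; apply: le_trans (nS x) _.
  by rewrite ler_wpM2r ?rnorm_ge0// (le_trans (ler_norm _))// lerDl.
have lower x : rnorm x ^+ 2 <= d * rdot (S x) x.
  have [->|x0] := eqVneq (rnorm x) 0; first by rewrite expr0n mulr_ge0// (le_trans ler01).
  have xp : 0 < rnorm x ^+ 2 by rewrite exprn_gt0// lt_neqAle eq_sym x0 rnorm_ge0.
  have := form_CauchySchwarz (P x) x lS sS S0; rewrite PK (rdotxx hn) expr2.
  have : rdot x (P x) <= d * rnorm x ^+ 2.
    apply: le_trans (ler_norm _) _; apply: le_trans (rdot_le hn _ _) _.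
    rewrite mulrC expr2 mulrA ler_wpM2r ?rnorm_ge0//; apply: le_trans (nP x) _.
    by rewrite ler_wpM2r ?rnorm_ge0// (le_trans (ler_norm _))// lerDl.
  move=> h1 /le_trans/(_ (ler_wpM2r (S0 x) h1)).
  by rewrite [leRHS]mulrAC ler_pM2r.
have cp : 0 < c by lra.
have dp : 0 < d by lra.
pose q := 1 - (c * d)^-1.
have q01 : 0 <= q < 1.
  rewrite /q subr_ge0 ltrBlDr ltrDl invr_gt0 mulr_gt0// andbT.
  by rewrite invf_le1 ?mulr_gt0//; rewrite -[1]mulr1 ler_pM.
pose A x := x - (c^-1)%:C *: S x.
have lA : linear A.
  move=> a x y; rewrite /A lS [in LHS]scalerDr opprD addrACA scalerBr !scalerA.
  by rewrite (mulrC a).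
have sA : symmetric_map ip A.
  by move=> x y; rewrite /A ipBl ipBr ipZl ipZr conjR sS.
have hA x : 0 <= rdot (A x) x <= q * rnorm x ^+ 2.
  rewrite /A rdotDl rdotNl rdotZl (rdotxx hn) /q.
  apply/andP; split; first by rewrite subr_ge0 ler_pdivrMl.
  rewrite mulrBl mul1r lerB// invfM -mulrA ler_wpM2l ?invr_ge0 ?(ltW cp)//.
  by rewrite ler_pdivrMl.
have [Z [lZ sZ [B nZ] ZE]] := sqrt_fixpoint lA sA q01 (form_norm_le lA sA hA).
pose t := Num.sqrt c; have t2 : t * t = c by rewrite -expr2 sqr_sqrtr// ltW.
exists (fun x => t%:C *: (x - Z x)); split.
- move=> a x y; rewrite lZ scalerA [a * _]mulrC -scalerA -scalerDr; congr (_ *: _).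
  by rewrite scalerBr opprD addrACA.
- by move=> x y; rewrite ipZl ipZr conjR ipBl ipBr sZ.
- exists (t * (1 + B)) => x; rewrite rnormZ_real ger0_norm ?sqrtr_ge0// -mulrA.
  rewrite ler_wpM2l ?sqrtr_ge0//; apply: le_trans (ler_rnormD _ _) _.
  by rewrite rnormN mulrDl mul1r lerD2l.
- move=> x; rewrite linZ// -scalerBr scalerA -rmorphM t2 linB//.
  have -> : x - Z x - (Z x - Z (Z x)) = x - A x.
    rewrite opprB [Z (Z x) - _]addrC addrA -[in LHS](addrA x) -opprD ZE.
    by rewrite opprD addrA subrK.
  by rewrite /A opprB addrC subrK scalerA -rmorphM divff ?gt_eqF// scale1r.
Qed.

End SymmetricOperators.
End Symmetric.

(** * Spectral theorem for compact symmetric operators *)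

Section Spectral.
Context {R : realType} {H : completeNormedModType R[i]}.
Implicit Types (x y z u v w : H).

Section CompactSymmetric.
Variable ip : {dot H for Num.conj}.
Hypothesis hn : hilbert_norm ip.
Local Notation rdot := (re_ip ip).

(** Let [m] be the norm of [M] on [V].  The images of unit vectors [x] of [V] that
    almost attain [m] have a cluster point [y].  Such an [x] is almost an
    eigenvector of [M^2] for [m^2], hence close to [v = M y / m^2], which
    therefore satisfies [M v = y] and [M^2 v = m^2 v].  Factoring [M^2 - m^2], either
    [M v = - m v] or [M v + m v] is an eigenvector for [m]. *)
Lemma compact_symmetric_eigenvector (M : H -> H) (V : set H) (C : R) (x0 : H) :
  compact_operator M -> symmetric_map ip M -> (forall x, rnorm (M x) <= C * rnorm x) ->
  lin_subspace V -> closed V -> (forall x, V x -> V (M x)) ->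
  V x0 -> M x0 <> 0 ->
  exists v (l : R[i]), [/\ V v, v <> 0 & M v = l *: v].
Proof.
move=> [lM cM] sM nM sV cV MV Vx0 Mx0.
pose B := [set x : H | V x /\ rnorm x = 1].
have nMB x : B x -> rnorm (M x) <= C by move=> [_ x1]; have := nM x; rewrite x1 mulr1.
have unit z : V z -> z <> 0 -> B ((rnorm z)^-1%:C *: z).
  move=> Vz z0; split; first exact: (lin_subspaceZ _ sV Vz).
  rewrite rnormZ_real ger0_norm ?invr_ge0 ?rnorm_ge0// mulVf//.
  by rewrite gt_eqF// rnorm_gt0.
have x0_neq0 : x0 <> 0 by move=> x00; apply: Mx0; rewrite x00 (lin0 lM).
pose D := [set rnorm (M x) | x in B].
have hD : has_sup D.
  split; first by eexists; exists ((rnorm x0)^-1%:C *: x0); first exact: unit.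
  by exists C => _ [x Bx <-]; exact: nMB.
pose m := sup D.
have le_m x : B x -> rnorm (M x) <= m.
  by move=> Bx; apply: sup_upper_bound => //; exists x.
have le_mz z : V z -> rnorm (M z) <= m * rnorm z.
  move=> Vz; have [->|z0] := pselect (z = 0); first by rewrite (lin0 lM) rnorm0 mulr0.
  have zp := rnorm_gt0 z0.
  have := le_m _ (unit z Vz z0).
  by rewrite linZ// rnormZ_real ger0_norm ?invr_ge0 ?rnorm_ge0// ler_pdivrMl// mulrC.
have m0 : 0 < m.
  have := lt_le_trans (rnorm_gt0 Mx0) (le_mz _ Vx0).
  by rewrite pmulr_lgt0// rnorm_gt0.
pose near_max e := [set x | B x /\ m - e < rnorm (M x)].
have [y hy] : exists y, forall e, 0 < e ->
    exists x, near_max e x /\ rnorm (y - M x) < e.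
  have [K MK [cK _]] : precompact (M @` B).
    apply: cM; exists 1; split; first exact: real1.
    by move=> r r1 x /= [_ x1]; rewrite rnormE x1 ltW.
  pose F := filter_from [set e : R | 0 < e] (fun e => M @` near_max e).
  have FF : ProperFilter F.
    apply: filter_from_proper; last first.
      move=> e /= e0; have [_ [x Bx <-] hx] := sup_adherent e0 hD.
      by exists (M x), x.
    apply: filter_from_filter; first by exists 1 => /=.
    move=> e f /= e0 f0; exists (Num.min e f) => /=; first by rewrite lt_min e0.
    move=> _ [x [Bx hx] <-]; split; exists x => //; split=> //.
      by apply: le_lt_trans hx; rewrite lerB// ge_min lexx.
    by apply: le_lt_trans hx; rewrite lerB// ge_min lexx orbT.
  have [|y [_ yF]] := cK F FF.
    by exists 1 => //= z [x [Bx _] <-]; apply: MK; exists x.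
  exists y => e e0.
  have [||_ [[x hx <-]]] := yF (M @` near_max e) (ball y e%:C).
  - by exists e.
  - by apply: nbhsx_ballx; rewrite ltcR.
  by rewrite -ball_normE /= rnormE ltcR; exists x.
(* expand the square, with [rdot (M (M x)) x = rnorm (M x) ^+ 2] close to [m ^+ 2] *)
have almost x e : near_max e x -> 0 < e ->
    rnorm (M (M x) - (m ^+ 2)%:C *: x) ^+ 2 <= 2 * m ^+ 3 * e.
  move=> [[Vx x1] hx] e0; rewrite (rnorm_sqB hn) rdotZr rnormZ_real exprMn x1 expr1n mulr1.
  rewrite symmetric_rdot// (rdotxx hn) ger0_norm ?sqr_ge0//.
  have h1 := le_mz _ (MV _ Vx).
  have h2 : rnorm (M (M x)) ^+ 2 <= m ^+ 2 * rnorm (M x) ^+ 2.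
    by rewrite -exprMn ler_sqr ?nnegrE ?mulr_ge0 ?rnorm_ge0// ltW.
  have h3 : m ^+ 2 - rnorm (M x) ^+ 2 <= 2 * m * e.
    have h4 := le_m _ (conj Vx x1); have h5 := rnorm_ge0 (M x).
    rewrite subr_sqr mulrC; apply: ler_pM; lra.
  have h6 : m ^+ 2 * (m ^+ 2 - rnorm (M x) ^+ 2) <= m ^+ 2 * (2 * m * e).
    by rewrite ler_wpM2l// sqr_ge0.
  move: h2 h6; move: (rnorm (M (M x)) ^+ 2) (rnorm (M x) ^+ 2) => a b; lra.
pose v := (m ^- 2)%:C *: M y.
(* [d1] and [d2] make each of the two terms of [v - x] at most [e / 2] *)
have approx e : 0 < e -> exists x, [/\ B x, rnorm (v - x) <= e & rnorm (y - M x) <= e].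
  move=> e0.
  pose d1 := m ^+ 2 * e / (2 * (`|C| + 1)).
  pose d2 := (m ^+ 2 * e / 2) ^+ 2 / (2 * m ^+ 3).
  have C1 : 0 < `|C| + 1 by rewrite ltr_wpDl.
  have d1p : 0 < d1 by rewrite divr_gt0 ?mulr_gt0 ?exprn_gt0.
  have d2p : 0 < d2 by rewrite divr_gt0 ?mulr_gt0 ?exprn_gt0 ?divr_gt0 ?mulr_gt0 ?exprn_gt0.
  pose d := Num.min e (Num.min d1 d2).
  have dp : 0 < d by rewrite !lt_min e0 d1p.
  have [de dd1 dd2] : [/\ d <= e, d <= d1 & d <= d2] by rewrite !ge_min !lexx !orbT.
  have [x [hx yx]] := hy d dp; exists x; split; first by case: hx.
    have -> : v - x = (m ^- 2)%:C *: (M (y - M x) + (M (M x) - (m ^+ 2)%:C *: x)).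
      rewrite linB// addrA subrK scalerBr scalerA -rmorphM mulVf ?scale1r//.
      by rewrite expf_neq0// gt_eqF.
    rewrite rnormZ_real ger0_norm ?invr_ge0 ?exprn_ge0 ?(ltW m0)//.
    rewrite ler_pdivrMl ?exprn_gt0//; apply: le_trans (ler_rnormD _ _) _.
    have h1 : rnorm (M (y - M x)) <= m ^+ 2 * e / 2.
      have a1 := nM (y - M x).
      have a2 : C * rnorm (y - M x) <= (`|C| + 1) * rnorm (y - M x).
        by rewrite ler_wpM2r ?rnorm_ge0// (le_trans (ler_norm _))// lerDl.
      have a3 : (`|C| + 1) * rnorm (y - M x) <= (`|C| + 1) * d1.
        by rewrite ler_wpM2l ?(ltW C1)// (le_trans (ltW yx)).
      have a4 : (`|C| + 1) * d1 = m ^+ 2 * e / 2 by rewrite /d1; field; rewrite gt_eqF.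
      lra.
    have h2 : rnorm (M (M x) - (m ^+ 2)%:C *: x) <= m ^+ 2 * e / 2.
      rewrite -ler_sqr ?nnegrE ?rnorm_ge0 ?divr_ge0 ?mulr_ge0 ?exprn_ge0 ?(ltW m0) ?(ltW e0)//.
      apply: le_trans (almost _ _ hx dp) _.
      by rewrite mulrC -ler_pdivlMr ?mulr_gt0 ?exprn_gt0.
    lra.
  by rewrite (le_trans (ltW yx)).
have MyE : M y = (m ^+ 2)%:C *: v.
  by rewrite scalerA -rmorphM divff ?scale1r// expf_neq0// gt_eqF.
have Vv : V v.
  rewrite (closure_id V).1//; apply/closure_rnormP => e e0.
  have [x [[Vx _] vx _]] := approx (e / 2) (divr_gt0 e0 (ltr0n R 2)).
  by exists x => //; apply: le_lt_trans vx _; lra.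
have v0 : v <> 0.
  move=> v0; have [|x [[_ x1] vx _]] := approx 2^-1; first by rewrite invr_gt0.
  by move: vx; rewrite v0 sub0r rnormN x1; lra.
have Mv : M v = y.
  apply/eqP; rewrite -subr_eq0; apply/eqP; apply: (@rnorm_small _ _ _ (C + 1)) => e e0.
  have [x [Bx vx yx]] := approx e e0.
  have -> : M v - y = M (v - x) - (y - M x) by rewrite (linB _ _ lM) opprB addrA subrK.
  apply: le_trans (ler_rnormD _ _) _; rewrite rnormN mulrDl mul1r lerD// (le_trans (nM _))//.
  by rewrite ler_wpM2l// (le_trans (rnorm_ge0 (M x)))// nMB.
have [w0|w0] := pselect (M v + m%:C *: v = 0).
  exists v, (- m%:C); split=> //.
  by rewrite scaleNr; apply/eqP; rewrite -addr_eq0; apply/eqP.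
exists (M v + m%:C *: v), m%:C; split=> //.
  by apply: lin_subspaceD => //; [exact: MV|exact: lin_subspaceZ].
by rewrite linD// linZ// Mv MyE scalerDr scalerA -rmorphM addrC expr2.
Qed.

Lemma lin_subspace_span (E : set H) : lin_subspace (lin_span E).
Proof.
split; first by exists 0%N, (fun=> 0), (fun=> 0); split=> [[]//|]; rewrite big_ord0.
move=> a _ _ [n [c [e [hc ->]]]] [m [d [f [hd ->]]]].
exists (n + m)%N, (fun i => match fintype.split i with inl j => a * c j | inr j => d j end),
  (fun i => match fintype.split i with inl j => e j | inr j => f j end).
split=> [i|]; first by case: fintype.split.
rewrite big_split_ord scaler_sumr; congr (_ + _); apply: eq_bigr => i _ /=.
  by case: split_ordP => j; [move/lshift_inj <-; rewrite scalerA|move/eqP; rewrite eq_lrshift].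
by case: split_ordP => j; [move/eqP; rewrite eq_rlshift|move/rshift_inj <-].
Qed.

Lemma mem_lin_span (E : set H) e : E e -> lin_span E e.
Proof.
move=> Ee; exists 1%N, (fun=> 1), (fun=> e); split=> //.
by rewrite big_ord1 scale1r.
Qed.

(** Each condition [ip x e = 0] is closed, as the kernel of a bounded functional. *)
Lemma closed_orthogonal (E : set H) : closed [set x | forall e, E e -> ip x e = 0].
Proof.
apply/closure_id; apply/seteqP; split; first exact: subset_closure.
move=> x cx e Ee /=; apply: (@closure_kernel R H (fun x => ip x e) (rnorm e)).
- by move=> u v; exact: ipBl.
- move=> u; have := norm_ip_le hn u e; rewrite -[`|_|]RRe_real ?ger0_real// lecR mulrC; exact.
- by move: x cx; apply: closureS => u /(_ e Ee).
Qed.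

(** A maximal orthonormal set [E] of eigenvectors exists by Zorn's lemma.  Were its
    span not dense, orthogonal projection would give a nonzero vector in the
    orthogonal complement of [E], which [M] preserves; injectivity makes [M]
    nonzero there, so it contains one more eigenvector. *)
Theorem compact_symmetric_eigenbasis (M : H -> H) (C : R) :
  compact_operator M -> symmetric_map ip M -> (forall x, rnorm (M x) <= C * rnorm x) ->
  injective M ->
  exists E, orthonormal_basis ip E /\ forall e, E e -> exists l : R[i], M e = l *: e.
Proof.
move=> cM sM nM iM; have [lM _] := cM.
pose P (E : set H) := (forall x y, E x -> E y -> ip x y = (x == y)%:R) /\
  forall e, E e -> exists l : R[i], M e = l *: e.
have [E [[onE evE] maxE]] : exists E, P E /\ forall B, E `<` B -> ~ P B.
  apply: Zorn_bigcup => F FP totF; split=> [x y [X FX Xx] [Y FY Yy]|x [X FX Xx]].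
    by have [XY|YX] := totF _ _ FX FY;
      [apply: (FP _ FY).1 => //; exact: XY|apply: (FP _ FX).1 => //; exact: YX].
  exact: (FP _ FX).2.
exists E; split=> //; split=> //.
apply: contrapT => notT.
have [x0 ncx0] : exists x0, ~ closure (lin_span E) x0.
  by apply/existsNP => all; apply: notT; apply/seteqP; split.
have [w cw ortho] := orth_proj hn x0 (lin_subspace_span E).
pose V := [set x | forall e, E e -> ip x e = 0].
have Vz : V (x0 - w) by move=> e /mem_lin_span; exact: ortho.
have Mz : M (x0 - w) <> 0.
  rewrite -(lin0 lM) => /iM/eqP; rewrite subr_eq0 => /eqP x0w.
  by apply: ncx0; rewrite x0w.
have sV : lin_subspace V.
  split=> [e _|a u v Vu Vv e Ee]; first by rewrite linear0l.
  by rewrite ipDl ipZl Vu// Vv// mulr0 addr0.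
have MV x : V x -> V (M x).
  by move=> Vx e Ee; rewrite sM; have [l ->] := evE _ Ee; rewrite ipZr Vx// mulr0.
have [v [l [Vv v0 Mv]]] :=
  compact_symmetric_eigenvector cM sM nM sV (@closed_orthogonal E) MV Vz Mz.
pose u := (rnorm v)^-1%:C *: v.
have uu : ip u u = 1.
  rewrite -hn rnormE rnormZ_real ger0_norm ?invr_ge0 ?rnorm_ge0// mulVf ?gt_eqF ?rnorm_gt0//.
  by rewrite rmorph1 expr1n.
have Vu : V u by exact: (lin_subspaceZ _ sV Vv).
have nEu : ~ E u by move=> /Vu; rewrite uu => /eqP; rewrite oner_eq0.
apply: (maxE (E `|` [set u])).
  split; first exact: subsetUl.
  by move=> /(_ u) h; apply: nEu; apply: h; right.
split=> [x y [Ex|->] [Ey|->]|x [Ex|->]].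
- exact: onE.
- by rewrite ipC Vu// rmorph0; case: eqP => // xu; case: nEu; rewrite -xu.
- by rewrite Vu//; case: eqP => // xu; case: nEu; rewrite xu.
- by rewrite uu eqxx.
- exact: evE.
- by exists l; rewrite linZ// Mv !scalerA mulrC.
Qed.

End CompactSymmetric.
End Spectral.

(** * Bounded, compact and partially defined operators *)

Section Operators.
Context {R : realType} {H : completeNormedModType R[i]}.
Implicit Types (x y z u v w f : H) (T S K : H -> H) (A L : operator H).

Lemma inverse_opP A f : correct_op A ->
  op_dom A (inverse_op A f) /\ A (inverse_op A f) = f.
Proof.
move=> [_ rA]; have : op_range A f by rewrite rA.
by move=> [u uA Auf]; apply: (@xgetPex _ 0 [set u | op_dom A u /\ A u = f]); exists u.
Qed.

Lemma bounded_real T : (exists2 C : R[i], 0 < C & forall x, `|T x| <= C * `|x|) ->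
  exists c : R, forall x, rnorm (T x) <= c * rnorm x.
Proof.
move=> [C C0 hC]; exists (complex.Re C) => x.
by rewrite -lecR rmorphM /= -!rnormE RRe_real// gtr0_real.
Qed.

Lemma real_bounded T (c : R) : (forall x, rnorm (T x) <= c * rnorm x) ->
  exists2 C : R[i], 0 < C & forall x, `|T x| <= C * `|x|.
Proof.
move=> hc; exists (`|c| + 1)%:C; first by rewrite ltcR ltr_wpDl.
move=> x; rewrite !rnormE -rmorphM lecR (le_trans (hc x))// ler_wpM2r ?rnorm_ge0//.
by rewrite (le_trans (ler_norm _))// lerDl.
Qed.

Lemma bounded_continuous T (c : R) : linear T -> (forall x, rnorm (T x) <= c * rnorm x) ->
  continuous T.
Proof.
move=> lT hc x; apply/cvgrPdist_lt => e e0.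
have e_real : e = (complex.Re e)%:C by rewrite RRe_real// gtr0_real.
have e0' : 0 < complex.Re e by rewrite -ltcR -e_real.
have c0 : 0 < `|c| + 1 by rewrite ltr_wpDl.
apply/nbhs_ballP; exists (complex.Re e / (`|c| + 1))%:C; first by rewrite /= ltcR divr_gt0.
move=> y; rewrite -ball_normE /= rnormE ltcR ltr_pdivlMr// => xy.
rewrite -(linB _ _ lT) rnormE e_real ltcR; apply: le_lt_trans xy.
rewrite (le_trans (hc _))// mulrC ler_wpM2l ?rnorm_ge0//.
by rewrite (le_trans (ler_norm _))// lerDl.
Qed.

Lemma bounded_setP (B : set H) :
  bounded_set B <-> exists b : R, forall x, B x -> rnorm x <= b.
Proof.
split=> [[M [Mr hM]]|[b hb]].
  exists (complex.Re M + 1) => x Bx; rewrite -lecR -rnormE rmorphD rmorph1 /= RRe_real//.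
  by apply: hM => //; rewrite ltrDl.
exists b%:C; split; first by rewrite complex_real.
by move=> r br x /hb xb; rewrite /= rnormE (le_trans _ (ltW br))// lecR.
Qed.

Lemma compact_comp T S (c d : R) G : linear T -> linear S ->
  (forall x, rnorm (T x) <= c * rnorm x) -> (forall x, rnorm (S x) <= d * rnorm x) ->
  compact_operator G -> compact_operator (fun x => T (G (S x))).
Proof.
move=> lT lS hT hS [lG cG]; split; first by move=> a x y; rewrite lS lG lT.
move=> B /bounded_setP[b hb].
have [K0 sub [cK _]] : precompact (G @` (S @` B)).
  apply: cG; apply/bounded_setP; exists (`|d| * b) => _ [x Bx <-].
  rewrite (le_trans (hS x))// (le_trans (ler_wpM2r (rnorm_ge0 _) (ler_norm d)))//.
  by rewrite ler_wpM2l// hb.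
have cT : compact (T @` K0).
  apply: continuous_compact => //; apply: continuous_subspaceT.
  exact: bounded_continuous hT.
exists (T @` K0).
  by move=> _ [x Bx <-]; exists (G (S x)) => //; apply: sub; exists (S x) => //; exists x.
by split=> //; apply: compact_closed => //; exact: norm_hausdorff.
Qed.

Lemma closure_prod_rnorm (A : set (H * H)) x y : closure A (x, y) ->
  forall e, 0 < e -> exists p, [/\ A p, rnorm (x - p.1) < e & rnorm (y - p.2) < e].
Proof.
move=> cA e e0; have [|p [Ap [/= p1 p2]]] := cA (ball x e%:C `*` ball y e%:C).
  by exists (ball x e%:C, ball y e%:C) => //; split; apply: nbhsx_ballx; rewrite ltcR.
by exists p; move: p1 p2; rewrite -!ball_normE /= !rnormE !ltcR.
Qed.

Lemma linear_op0 A : linear_op A -> A 0 = 0.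
Proof.
move=> [d0 lA]; have [_] := lA (-1) 0 0 d0 d0.
by rewrite scaler0 addr0 scaleN1r addNr.
Qed.

Lemma linear_opZ A (a : R[i]) u : linear_op A -> op_dom A u ->
  op_dom A (a *: u) /\ A (a *: u) = a *: A u.
Proof.
move=> lA Au; have [d0 h] := lA.
by have := h a u 0 Au d0; rewrite !addr0 (linear_op0 lA) addr0.
Qed.

(** The eigenvalue [l] of the inverse cannot vanish, since [A 0 = 0]. *)
Lemma eigenvector_inverse A (l : R[i]) u : linear_op A -> correct_op A -> u <> 0 ->
  inverse_op A u = l *: u -> eigenvector A u.
Proof.
move=> lA cA u0 iu; have [dA Au] := inverse_opP u cA; rewrite iu in dA Au.
have l0 : l != 0.
  by apply/eqP => l0; apply: u0; rewrite -Au l0 scale0r linear_op0.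
have [] := linear_opZ l^-1 lA dA; rewrite Au scalerA mulVf// scale1r => dAu eAu.
by split=> //; exists (l^-1).
Qed.

Section AdjointClosure.
Variable ip : {dot H for Num.conj}.
Hypothesis hn : hilbert_norm ip.
Local Notation rdot := (re_ip ip).

Lemma adjoint_opP A y : op_dom (adjoint_op ip A) y ->
  forall x, op_dom A x -> ip (A x) y = ip x (adjoint_op ip A y).
Proof. by move=> hy; exact: (xgetPex 0 hy). Qed.

Lemma selfadjoint_symmetric L u v : selfadjoint_op ip L ->
  op_dom L u -> op_dom L v -> ip (L u) v = ip u (L v).
Proof. by move=> [_ [[sub eqL] _]] du dv; rewrite (adjoint_opP (sub _ dv) du) eqL. Qed.

Lemma inverse_op_symmetric L : selfadjoint_op ip L -> correct_op L ->
  symmetric_map ip (inverse_op L).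
Proof.
move=> sL cL x y; have [dx Lx] := inverse_opP x cL; have [dy Ly] := inverse_opP y cL.
by rewrite -[in LHS]Ly -[in RHS]Lx (selfadjoint_symmetric sL).
Qed.

Lemma bounded_adjoint_dom T (c : R) y : linear T -> (forall x, rnorm (T x) <= c * rnorm x) ->
  op_dom (adjoint_op ip (everywhere_op T)) y.
Proof.
move=> lT hT; have [||z hz] := @riesz _ _ ip hn (fun x => ip (T x) y) (c * rnorm y).
- by move=> a u v; rewrite lT ipDl ipZl.
- move=> x; rewrite -lecR RRe_real ?ger0_real//; apply: le_trans (norm_ip_le hn _ _) _.
  by rewrite lecR mulrAC ler_wpM2r ?rnorm_ge0.
by exists z => x _; exact: hz.
Qed.

(** The closure of the graph of [K L] is single-valued: by continuity every
    [(x, y)] in it satisfies [dual], and this determines the inner products of [y]. *)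
Lemma closure_comp_op K (c : R) L u : linear K -> (forall x, rnorm (K x) <= c * rnorm x) ->
  selfadjoint_op ip L ->
  op_range (adjoint_op ip (everywhere_op K)) `<=` op_dom L ->
  op_dom L u -> closure_op (comp_op K L) u = K (L u).
Proof.
move=> lK hK sL ranK du.
pose Ks := adjoint_op ip (everywhere_op K).
have KsP x z : ip (K x) z = ip x (Ks z).
  exact: (adjoint_opP (bounded_adjoint_dom z lK hK)).
have dKs z : op_dom L (Ks z).
  by apply: ranK; exists z => //; exact: bounded_adjoint_dom hK.
have dual x y z : closure (op_graph (comp_op K L)) (x, y) -> rdot y z = rdot x (L (Ks z)).
  move=> /closure_prod_rnorm cl; apply/eqP; rewrite -subr_eq0 -normr_le0.
  apply/ler_addgt0Pr => e e0; rewrite add0r.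
  pose b := rnorm z + rnorm (L (Ks z)) + 1.
  have b0 : 0 < b by rewrite ltr_wpDl ?addr_ge0 ?rnorm_ge0.
  have [[v _] [[/= dv <-] xv yv]] := cl _ (divr_gt0 e0 b0).
  have -> : rdot y z - rdot x (L (Ks z)) = rdot (y - K (L v)) z - rdot (x - v) (L (Ks z)).
    rewrite !rdotDl !rdotNl; suff -> : rdot (K (L v)) z = rdot v (L (Ks z)) by ring.
    by rewrite /re_ip KsP (selfadjoint_symmetric sL).
  apply: le_trans (ler_normB _ _) _.
  have h1 := le_trans (rdot_le hn _ _) (ler_wpM2r (rnorm_ge0 z) (ltW yv)).
  have h2 := le_trans (rdot_le hn _ _) (ler_wpM2r (rnorm_ge0 (L (Ks z))) (ltW xv)).
  have h3 : e / b * b = e by rewrite divfK// gt_eqF.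
  have h4 : 0 < e / b by rewrite divr_gt0.
  rewrite {2}/b !mulrDr mulr1 in h3; lra.
have graph_u : closure (op_graph (comp_op K L)) (u, K (L u)) by apply: subset_closure; split.
have graph_u' : closure (op_graph (comp_op K L)) (u, closure_op (comp_op K L) u).
  have ex_y : [set y | closure (op_graph (comp_op K L)) (u, y)] !=set0 by exists (K (L u)).
  exact: (xgetPex 0 ex_y).
set y := closure_op (comp_op K L) u in graph_u' *.
apply/eqP; rewrite -subr_eq0; apply/eqP/rnorm_eq0/eqP; rewrite -sqrf_eq0 -(rdotxx hn).
by rewrite {1}rdotDl rdotNl (dual _ _ _ graph_u) (dual _ _ _ graph_u') subrr.
Qed.
End AdjointClosure.
End Operators.

(** * The Riesz basis of eigenvectors *)

Unset Implicit Arguments.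

Theorem corollary1p2 (R : realType) (H : completeNormedModType R[i])
    (ip : {dot H for Num.conj}) (L0 L LK : operator H) (K : H -> H) :
  hilbert_norm ip ->
  linear_op L0 -> symmetric_op ip L0 -> minimal_op L0 ->
  let Lhat := adjoint_op ip L0 in
  maximal_op Lhat ->
  linear_op L -> selfadjoint_op ip L -> correct_op L -> restriction L0 L ->
  linear_op LK -> correct_op LK -> restriction LK Lhat ->
  bounded_linear K ->
  (forall f : H, op_ker Lhat (K f)) ->
  (forall f : H, inverse_op LK f = inverse_op L f + K f) ->
  op_range (adjoint_op ip (everywhere_op K)) `<=` op_dom L ->
  let KL := closure_op (comp_op K L) in
  let I_KL := (fun x : H => x + KL x) in
  nonneg_op ip I_KL ->
  invertible I_KL ->
  compact_operator (inverse_op L) ->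
  exists B : set H, riesz_basis ip B /\ (forall u, B u -> eigenvector LK u).
Proof.
move=> hn _ _ _ Lhat _ lL sL cL _ lLK cLK _ [lK bK] _ LKE ranK KL S S0 [P [[lP bP] SK PK]] cG.
pose G := inverse_op L.
have lG : linear G by case: cG.
have GP f : op_dom L (G f) /\ L (G f) = f by exact: inverse_opP.
have [kb hK] := bounded_real bK.
have [pb hP] := bounded_real bP.
have [gb hG] : exists c : R, forall x, rnorm (G x) <= c * rnorm x.
  apply: bounded_real; have [[C C0 hC] _] := cL; exists C => // f.
  by have [dG LG] := GP f; rewrite -[in leRHS]LG hC.
have SG f : S (G f) = inverse_op LK f.
  have [dG LG] := GP f.
  by rewrite LKE /S /KL (closure_comp_op hn lK hK sL ranK dG) LG.
have lS : linear S by move=> a x y; rewrite -{1}(SK x) -{1}(SK y) -lP PK.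
have sS := nonneg_symmetric lS S0.
have [sb hS] := hellinger_toeplitz hn lS sS.
have [T [lT sT [tb hT] TT]] : exists T, [/\ linear T, symmetric_map ip T,
    exists b : R, forall x, rnorm (T x) <= b * rnorm x & forall x, T (T x) = S x].
  apply: (positive_sqrt hn lS sS _ hS PK hP) => x.
  by have := S0 x; rewrite lecE => /andP[].
have sG := inverse_op_symmetric sL cL.
(* [M = T^-1 (S G) T], in the form that shows its symmetry *)
pose M x := T (G (T x)).
have iT : injective T by apply: (can_inj (g := P \o T)) => x /=; rewrite TT SK.
have iG : injective G by apply: (can_inj (g := L)) => f; case: (GP f).
have [E [onE evE]] : exists E, orthonormal_basis ip E /\
    forall e, E e -> exists l : R[i], M e = l *: e.
  apply: (compact_symmetric_eigenbasis hn (C := `|tb| * (`|gb| * `|tb|))).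
  - exact: (compact_comp lT lT hT hT cG).
  - by move=> x y; rewrite /M sT sG sT.
  - move=> x; rewrite /M.
    apply: le_trans (hT _) _; apply: le_trans (ler_wpM2r (rnorm_ge0 _) (ler_norm _)) _.
    rewrite -!mulrA ler_wpM2l//.
    apply: le_trans (hG _) _; apply: le_trans (ler_wpM2r (rnorm_ge0 _) (ler_norm _)) _.
    rewrite ler_wpM2l//.
    by apply: le_trans (hT _) _; rewrite ler_wpM2r ?rnorm_ge0 ?ler_norm.
  - by move=> x y /iT/iG/iT.
exists (T @` E); split.
  exists E, T; split=> //; first by split=> //; exact: real_bounded hT.
  exists (fun x => T (P x)); split.
  - split; first by move=> a x y; rewrite lP lT.
    apply: (@real_bounded _ _ _ (`|tb| * pb)) => x.
    apply: le_trans (hT _) _; apply: le_trans (ler_wpM2r (rnorm_ge0 _) (ler_norm _)) _.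
    by rewrite -mulrA ler_wpM2l.
  - by move=> x; apply: iT; rewrite TT PK.
  - by move=> x; rewrite TT PK.
move=> _ [e Ee <-].
have [l Me] := evE _ Ee.
apply: (eigenvector_inverse (l := l)) => //.
  rewrite -(lin0 lT) => /iT e0.
  have := proj1 onE e e Ee Ee; rewrite eqxx e0 linear0l => /eqP.
  by rewrite eq_sym oner_eq0.
by rewrite -SG -TT -[T (G _)]/(M e) Me linZ.
Qed.
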